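(* Let $d\ge 2$, let $V\subset\mathbb{R}^d$ be an admissible hyperplane splitting $\mathbb{R}^d_+$ into closed parts $K_1,K_2$, let $K'=\mathbb{R}^d_+\cap V$, and let $\varphi$ be a self-dual antinorm on $K'$ with orthogonal extension $\Phi$ to $\mathbb{R}^d_+$. Let $f_1:K_1\to\mathbb{R}_+$ be an arbitrary antinorm on $K_1$ such that $f_1=\varphi$ on $K'$ and $f_1\le\Phi$ on $K_1$. Then the function $f:\mathbb{R}^d_+\to\mathbb{R}_+$ defined by $$f(x)=\begin{cases} f_1(x), & x\in K_1,\\[2pt] \displaystyle\inf_{z\in K_1}\frac{(x,z)}{f_1(z)}, & x\notin K_1,\end{cases}$$ is a self-dual antinorm on $\mathbb{R}^d_+$.
   Context: $(\cdot,\cdot)$ is the standard inner product of $\mathbb{R}^d$; $\mathbb{R}^d_+$ is the closed nonnegative orthant. An antinorm on a closed convex cone $K$ is a concave, nonnegative, somewhere positive function $f:K\to\mathbb{R}_+$ with $f(\lambda x)=\lambda f(x)$ for $\lambda\ge 0$; all antinorms are assumed continuous on $K$. In every infimum of a quotient $\frac{(y,x)}{f(x)}$, only points $x$ with $f(x)\neq 0$ are considered. The dual of an antinorm $f$ on $\mathbb{R}^d_+$ is $f^*(y)=\inf_{x\in\mathbb{R}^d_+}\frac{(y,x)}{f(x)}$, $y\in\mathbb{R}^d_+$; $f$ is self-dual if $f^*=f$. A hyperplane $V$ is admissible if $V=\{x\in\mathbb{R}^d: x_i=\mu x_j\}$ for two different indices $i,j$ and some $\mu\ge 0$. Then $K'=\mathbb{R}^d_+\cap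 V$ is a $(d-1)$-dimensional orthant (the cone generated by $d-1$ pairwise orthogonal vectors), and the closed parts $K_1,K_2$ are the intersections of $\mathbb{R}^d_+$ with the two closed half-spaces bounded by $V$, labelled in either order (if $\mu=0$, one of them equals $K'$). Duality for an antinorm $\varphi$ on $K'$ is taken inside $K'\cong\mathbb{R}^{d-1}_+$: $\varphi^*(y)=\inf_{x\in K'}\frac{(y,x)}{\varphi(x)}$, $y\in K'$; $\varphi$ is self-dual if $\varphi^*=\varphi$. The orthogonal extension of $\varphi$ is $\Phi(x)=\varphi(x')$, $x\in\mathbb{R}^d_+$, where $x'$ is the orthogonal projection of $x$ onto $V$ (which lies in $K'$). *)

(* Defs.v *)
From HB Require Import structures.
From mathcomp Require Import all_boot all_order all_algebra.
From mathcomp Require Import all_classical all_reals all_analysis.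
Set Implicit Arguments.
Unset Strict Implicit.
Unset Printing Implicit Defensive.
Import Order.TTheory GRing.Theory Num.Theory.
Import numFieldNormedType.Exports.
Local Open Scope classical_set_scope.
Local Open Scope ring_scope.

(* Functions on a cone K are total functions on R^d; every notion below that
   is relative to K depends only on their values on K. *)

Definition dot (R : realType) (d : nat) (x y : 'rV[R]_d) : R :=
  \sum_(k < d) x 0 k * y 0 k.

Definition orthant (R : realType) (d : nat) : set 'rV[R]_d :=
  [set x | forall k, 0 <= x 0 k].

Definition concave_on (R : realType) (d : nat) (K : set 'rV[R]_d)
    (f : 'rV[R]_d -> R) : Prop :=
  convex_function K (fun x => - f x).

Definition antinorm (R : realType) (d : nat) (K : set 'rV[R]_d)
    (f : 'rV[R]_d -> R) : Prop :=
  [/\ concave_on K f,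
      (forall x, K x -> 0 <= f x),
      (exists2 x, K x & 0 < f x),
      (forall x (t : R), K x -> 0 <= t -> f (t *: x) = t * f x)
    & {within K, continuous f}].

(* The infimum is that of the reals. It is never degenerate when f is an
   antinorm on K and K and y lie in the orthant: the set of quotients is then
   nonempty and bounded below by 0. *)
Definition antinorm_dual (R : realType) (d : nat) (K : set 'rV[R]_d)
    (f : 'rV[R]_d -> R) (y : 'rV[R]_d) : R :=
  inf [set dot y x / f x | x in K `&` [set x | f x != 0]].

Definition self_dual (R : realType) (d : nat) (K : set 'rV[R]_d)
    (f : 'rV[R]_d -> R) : Prop :=
  forall y, K y -> antinorm_dual K f y = f y.

Definition admissible (R : realType) (d : nat) (V : set 'rV[R]_d) : Prop :=
  exists (i j : 'I_d) (mu : R),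
    [/\ i != j, 0 <= mu & V = [set x | x 0 i = mu * x 0 j]].

(* The normal vector a may be replaced by - a, so that (K1, K2) and (K2, K1)
   are both allowed. *)
Definition closed_parts (R : realType) (d : nat) (V K1 K2 : set 'rV[R]_d) :
    Prop :=
  exists a : 'rV[R]_d,
    [/\ a != 0, V = [set x | dot a x = 0],
        K1 = @orthant R d `&` [set x | 0 <= dot a x]
      & K2 = @orthant R d `&` [set x | dot a x <= 0]].

(* The defining condition has exactly one solution p when V is a linear
   subspace; 0 is a dummy value otherwise. *)
Definition orthogonal_proj (R : realType) (d : nat) (V : set 'rV[R]_d)
    (x : 'rV[R]_d) : 'rV[R]_d :=
  xget 0 [set p | V p /\ forall v, V v -> dot (x - p) v = 0].

Definition orthogonal_extension (R : realType) (d : nat) (V : set 'rV[R]_d)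
    (phi : 'rV[R]_d -> R) (x : 'rV[R]_d) : R :=
  phi (orthogonal_proj V x).

Definition dual_extension (R : realType) (d : nat) (K1 : set 'rV[R]_d)
    (f1 : 'rV[R]_d -> R) (x : 'rV[R]_d) : R :=
  if x \in K1 then f1 x else antinorm_dual K1 f1 x.

(* Main.v *)
(* If (x, y) >= f x * f y on the orthant and f^* <= f, then f = f^*; being an
   infimum of linear forms, f is then concave, homogeneous and upper
   semicontinuous, and being nondecreasing and homogeneous on the orthant it is
   lower semicontinuous, so f is automatically an antinorm.

   The first inequality holds by definition of f for points on opposite sides
   of V; for points on the same side it follows from f <= Phi and the
   self-duality of phi.  On the complement of K1, f^* <= f is clear.  At y in K1,
   a supporting functional l >= f1 on K1 with (l, y) < f1 y + e is produced.  If
   (a, l) >= 0, where a is the normal of V pointing to K1, the projection l' of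
   l onto V lies in K' with phi l' >= 1 and (l', y) <= (l, y); otherwise l lies
   in K2 and f l >= 1.  Either way f^* y < f1 y + e. *)
Require Import Defs.
From HB Require Import structures.
From mathcomp Require Import all_boot all_order all_algebra.
From mathcomp Require Import all_classical all_reals all_analysis.
From mathcomp Require Import ring lra.
Set Implicit Arguments.
Unset Strict Implicit.
Unset Printing Implicit Defensive.
Import Order.TTheory GRing.Theory Num.Theory.
Import numFieldNormedType.Exports.
Local Open Scope classical_set_scope.
Local Open Scope ring_scope.

(** * Inner product, the closed orthant and half-spaces *)

Section DotProduct.
Variables (R : realType) (d : nat).
Implicit Types (x y z a : 'rV[R]_d) (t : R).

Lemma dotC x y : dot x y = dot y x.
Proof. by apply: eq_bigr => k _; rewrite mulrC. Qed.

Lemma dotDl x y z : dot (x + y) z = dot x z + dot y z.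
Proof. by rewrite -big_split; apply: eq_bigr => k _; rewrite mxE mulrDl. Qed.

Lemma dotZl t x y : dot (t *: x) y = t * dot x y.
Proof. by rewrite mulr_sumr; apply: eq_bigr => k _; rewrite mxE mulrA. Qed.

Lemma dotBl x y z : dot (x - y) z = dot x z - dot y z.
Proof. by rewrite -scaleN1r dotDl dotZl mulN1r. Qed.

Lemma dotDr x y z : dot z (x + y) = dot z x + dot z y.
Proof. by rewrite !(dotC z) dotDl. Qed.

Lemma dotBr x y z : dot z (x - y) = dot z x - dot z y.
Proof. by rewrite !(dotC z) dotBl. Qed.

Lemma dotZr t x y : dot x (t *: y) = t * dot x y.
Proof. by rewrite !(dotC x) dotZl. Qed.

Lemma dot_delta x k : dot x (delta_mx 0 k) = x 0 k.
Proof.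
rewrite /dot (bigD1 k)//= big1 => [|l lk]; first by rewrite mxE !eqxx mulr1 addr0.
by rewrite mxE (negPf lk) andbF mulr0.
Qed.

Lemma dotxx_ge0 x : 0 <= dot x x.
Proof. by apply: sumr_ge0 => k _; rewrite -expr2 sqr_ge0. Qed.

Lemma sqr_coord_le x k : x 0 k ^+ 2 <= dot x x.
Proof.
rewrite /dot (bigD1 k)//= -expr2 lerDl.
by apply: sumr_ge0 => l _; rewrite -expr2 sqr_ge0.
Qed.

Lemma dotxx_eq0 x : (dot x x == 0) = (x == 0).
Proof.
apply/eqP/eqP => [x0|->].
  apply/rowP => k; apply/eqP; rewrite mxE -sqrf_eq0 eq_le sqr_ge0 andbT -x0.
  exact: sqr_coord_le.
by rewrite -(scale0r 0) dotZl mul0r.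
Qed.

Lemma dotxx_gt0 x : x != 0 -> 0 < dot x x.
Proof. by move=> x0; rewrite lt_def dotxx_eq0 x0 dotxx_ge0. Qed.

Lemma dot_ge0 x y : orthant x -> orthant y -> 0 <= dot x y.
Proof. by move=> x0 y0; apply: sumr_ge0 => k _; rewrite mulr_ge0. Qed.

Lemma orthantD x y : orthant x -> orthant y -> orthant (x + y).
Proof. by move=> x0 y0 k; rewrite mxE addr_ge0. Qed.

Lemma orthantZ t x : 0 <= t -> orthant x -> orthant (t *: x).
Proof. by move=> t0 x0 k; rewrite mxE mulr_ge0. Qed.

Lemma dot_continuous y : continuous (fun x => dot x y).
Proof.
apply: (@continuous_big _ _ +%R) => [|k _ x]; first exact: add_continuous.
apply: (@cvgM _ _ (nbhs x)); last exact: cvg_cst.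
exact: (@coord_continuous R 1 d 0 k x).
Qed.

Lemma dotxx_continuous : continuous (fun x => dot x x).
Proof.
apply: (@continuous_big _ _ +%R) => [|k _ x]; first exact: add_continuous.
by apply: (@cvgM _ _ (nbhs x)); exact: (@coord_continuous R 1 d 0 k x).
Qed.

Lemma closed_orthant : closed (@orthant R d).
Proof.
have -> : @orthant R d = \bigcap_(k in setT) [set x | 0 <= x 0 k].
  by apply/seteqP; split => x /= h k => [_|]; exact: h.
apply: closed_bigI => k _.
apply: (@preimage_closed _ _ (fun x : 'rV[R]_d => x 0 k) [set t | 0 <= t]).
  by move=> x _; exact: (@coord_continuous R 1 d 0 k x).
exact: closed_ge.
Qed.

Lemma closed_dot_ge0 a : closed [set x | 0 <= dot a x].
Proof.
apply: (@preimage_closed _ _ (fun x => dot a x) [set t | 0 <= t]).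
  move=> x _; under eq_fun do rewrite dotC; exact: dot_continuous.
exact: closed_ge.
Qed.

End DotProduct.

(** * Duals on a subcone of the orthant, and regularity of self-dual functions *)

Section Dual.
Variables (R : realType) (d : nat) (K : set 'rV[R]_d) (f : 'rV[R]_d -> R).
Hypotheses (K_orthant : K `<=` @orthant R d)
  (f_ge0 : forall x, K x -> 0 <= f x) (f_gt0 : exists2 x, K x & 0 < f x).

(** The product form also covers points with [f x = 0], which the infimum skips: there the claim is
    only [0 <= dot y x]. *)
Lemma antinorm_dual_mul_le x y :
  orthant y -> K x -> antinorm_dual K f y * f x <= dot y x.
Proof.
move=> y0 Kx; have [fx0|fx0] := eqVneq (f x) 0.
  by rewrite fx0 mulr0 dot_ge0//; exact: K_orthant.
rewrite -ler_pdivlMr; last by rewrite lt_def fx0 f_ge0.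
apply: ge_inf; last by exists x.
exists 0 => _ [z [Kz _] <-].
by rewrite divr_ge0 ?f_ge0// dot_ge0//; exact: K_orthant.
Qed.

Lemma le_antinorm_dual c y :
  (forall x, K x -> c * f x <= dot y x) -> c <= antinorm_dual K f y.
Proof.
move=> cy; apply: lb_le_inf.
  (* A point with [f x > 0] makes the set of quotients nonempty; on the empty set [inf] takes a
     default value. *)
  have [x Kx fx0] := f_gt0; exists (dot y x / f x).
  by exists x => //; split=> //=; rewrite gt_eqF.
move=> _ [x [Kx /= fx0] <-]; rewrite ler_pdivlMr ?cy//.
by rewrite lt_def fx0 f_ge0.
Qed.

End Dual.

(** By self-duality, [c <= f y] holds exactly when [c * f x <= dot y x] for all [x] in the orthant.
    The axioms reduce to such linear tests, which [mulf] settles. *)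
Lemma self_dual_antinorm (R : realType) (d : nat) (f : 'rV[R]_d -> R) :
    (forall x, orthant x -> 0 <= f x) -> (exists2 x, orthant x & 0 < f x) ->
  self_dual (@orthant R d) f -> antinorm (@orthant R d) f.
Proof.
move=> f_ge0 f_gt0 sd.
have mulf x y : orthant x -> orthant y -> f x * f y <= dot x y.
  by move=> x0 y0; rewrite -(sd x)//; exact: antinorm_dual_mul_le.
have lef c y : orthant y ->
    (forall x, orthant x -> c * f x <= dot y x) -> c <= f y.
  by move=> y0 h; rewrite -(sd y)//; exact: le_antinorm_dual.
have f_nondec x y : orthant x -> orthant (y - x) -> f x <= f y.
  move=> x0 yx0; have y0 : orthant y by rewrite -(subrK x y); exact: orthantD.
  apply: lef => // z z0; apply: le_trans (mulf x z x0 z0) _.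
  by rewrite -subr_ge0 -dotBl dot_ge0.
have leZ x t : orthant x -> 0 <= t -> t * f x <= f (t *: x).
  move=> x0 t0; apply: lef => [|z z0]; first exact: orthantZ.
  by rewrite dotZl -mulrA ler_wpM2l// mulf.
split => //.
- move=> t x y /set_mem x0 /set_mem y0.
  have t0 : 0 <= t%:num by [].
  have t1 : 0 <= 1 - t%:num by rewrite subr_ge0.
  change (- f (t%:num *: x + (1 - t%:num) *: y)
    <= t%:num * - f x + (1 - t%:num) * - f y).
  rewrite !mulrN -opprD lerN2.
  apply: lef => [|z z0]; first by apply: orthantD; exact: orthantZ.
  rewrite dotDl !dotZl mulrDl -!mulrA.
  by rewrite lerD// ler_wpM2l// mulf.
- move=> x t x0; rewrite le_eqVlt => /predU1P[<-|t0].
    rewrite scale0r mul0r; apply/eqP; rewrite eq_le f_ge0 ?andbT; last first.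
      by move=> k; rewrite mxE.
    have [z z0 fz0] := f_gt0; rewrite -(pmulr_lle0 _ fz0).
    rewrite -(scale0r z) (le_trans (mulf _ _ _ z0))//.
      exact: orthantZ.
    by rewrite dotZl mul0r.
  apply/eqP; rewrite eq_le (leZ _ _ x0 (ltW t0)) andbT -ler_pdivrMl//.
  rewrite (le_trans (leZ _ _ _ _))//; first by apply: orthantZ => //; exact: ltW.
    by rewrite invr_ge0 ltW.
  by rewrite scalerA mulVf ?gt_eqF// scale1r.
- apply/subspace_continuousP => y y0; apply/cvgrPdist_lt => e e0.
  have fy0 := f_ge0 _ y0; have fye : 0 < f y + e by rewrite ltr_wpDl.
  (* A near-minimizer [z] for [y]: the strict inequality persists near [y], and [mulf] turns it into
     [f x < f y + e]. *)
  have [z [z0 yz]] : exists z, orthant z /\ dot y z < (f y + e) * f z.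
    apply: contrapT => nz; have : f y + e <= f y; last by rewrite gerDl leNgt e0.
    apply: lef => // z z0; rewrite leNgt; apply/negP => yz; apply: nz; by exists z.
  have fz0 : 0 < f z.
    by rewrite -(pmulr_rgt0 _ fye) (le_lt_trans _ yz)// dot_ge0.
  (* This [t] satisfies [t * f y > f y - e]. As [t < 1], points of the orthant near [y] dominate
     [t *: y] coordinatewise, zero coordinates of [y] being harmless, so monotonicity bounds [f]
     from below. *)
  set t := f y / (f y + e).
  have t0 : 0 <= t by rewrite divr_ge0// ltW.
  have t1 : t < 1 by rewrite ltr_pdivrMr// mul1r ltrDl.
  have tfy : f y - e < t * f y.
    by rewrite /t mulrAC ltr_pdivlMr//; nra.
  have upper : \forall x \near y, dot x z < (f y + e) * f z.
    exact: cvgr_lt (dot_continuous (x:=y)) _ yz.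
  have lower : \forall x \near y, forall k,
      0 < y 0 k -> t * y 0 k < (x : 'rV[R]_d) 0 k.
    apply: (@filter_forall _ _ _ (nbhs y)) => k.
    have [yk0|yk0] := ltP 0 (y 0 k); last exact: nearW.
    have tyk : t * y 0 k < y 0 k by rewrite gtr_pMl.
    by near=> x => _; near: x; exact: cvgr_gt (@coord_continuous R 1 d 0 k y) _ tyk.
  rewrite near_withinE; near=> x => x0.
  rewrite distrC ltr_distl; apply/andP; split.
    apply: lt_le_trans tfy _; apply: le_trans (leZ _ _ y0 t0) _.
    apply: f_nondec; first exact: orthantZ.
    have low : forall k, 0 < y 0 k -> t * y 0 k < x 0 k by near: x.
    move=> k; rewrite !mxE subr_ge0.
    have := y0 k; rewrite le_eqVlt => /predU1P[<-|/low/ltW//].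
    by rewrite mulr0 x0.
  rewrite -(ltr_pM2r fz0); apply: le_lt_trans (mulf x z x0 z0) _.
  by near: x.
Unshelve. all: by end_near. Qed.

(** * Supporting functionals of an antinorm *)

Lemma antinorm_superadd (R : realType) (d : nat) (K : set 'rV[R]_d)
    (f : 'rV[R]_d -> R) (x y : 'rV[R]_d) :
    antinorm K f -> (forall t z, K z -> 0 <= t -> K (t *: z)) -> K x -> K y ->
  f x + f y <= f (x + y).
Proof.
move=> [cf _ _ fZ _] KZ Kx Ky.
have two0 : 0 <= 2 :> R by [].
have half0 : 0 <= 2^-1 :> R by rewrite invr_ge0.
have half1 : 2^-1 <= 1 :> R by lra.
(* The midpoint of [2 *: x] and [2 *: y] is [x + y]. *)
have := cf (Itv01 half0 half1) (2 *: x) (2 *: y) (mem_set (KZ _ _ Kx two0))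
  (mem_set (KZ _ _ Ky two0)).
change (- f (2^-1 *: (2 *: x) + (1 - 2^-1) *: (2 *: y))
  <= 2^-1 * - f (2 *: x) + (1 - 2^-1) * - f (2 *: y) -> f x + f y <= f (x + y)).
rewrite !fZ// !scalerA mulVf// (_ : (1 - 2^-1) * 2 = 1 :> R); last by field.
rewrite !scale1r => h; lra.
Qed.

(* Project the point (y, f y + e) onto the closed hypograph of f: the direction
   of projection, normalized to have last coordinate -1, is the wanted l. *)
Lemma antinorm_supporting (R : realType) (d : nat) (K : set 'rV[R]_d)
    (f : 'rV[R]_d -> R) (y : 'rV[R]_d) (e : R) :
    closed K -> (forall x z, K x -> K z -> K (x + z)) ->
    (forall t z, K z -> 0 <= t -> K (t *: z)) ->
    antinorm K f -> K y -> 0 < e ->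
  exists2 l, (forall x, K x -> f x <= dot l x) & dot l y < f y + e.
Proof.
move=> closedK KD KZ anf Ky e0.
have fD x z : K x -> K z -> f x + f z <= f (x + z).
  exact: antinorm_superadd.
have [_ f0 _ fZ fc] := anf.
pose T := f y + e.
pose s x := Num.max 0 (T - f x).
(* [F x] is the squared distance from [(y, T)] to the part of the hypograph above [x], the half-line
   of heights at most [f x]. *)
pose F x := dot (x - y) (x - y) + s x ^+ 2.
have s0 x : 0 <= s x by rewrite le_max lexx.
have Ts x : T - f x <= s x by rewrite le_max lexx orbT.
have Fy : F y = e ^+ 2.
  rewrite /F subrr -(scale0r 0) dotZl mul0r add0r /s /T addrAC subrr add0r.
  by rewrite max_r// ltW.
have [x0 Kx0 Fmin] : exists2 x0, K x0 & forall x, K x -> F x0 <= F x.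
  (* Outside this box [F x >= e ^+ 2 = F y], so a minimum over the compact set [B] intersected with
     [K] is global on [K]. *)
  pose B := [set x : 'rV[R]_d | forall k, `[y 0 k - e, y 0 k + e]%classic (x 0 k)].
  have compactKB : compact (B `&` K).
    apply: compact_closedI => //.
    apply: (@rV_compact R d (fun k => `[y 0 k - e, y 0 k + e]%classic)) => k.
    exact: segment_compact.
  have KBy : (B `&` K) y.
    by split=> // k /=; rewrite in_itv/= lerDl lerBlDr lerDl ltW.
  have Fc : {within B `&` K, continuous F}.
    have -> : F = ((fun x => dot x x) \- (fun x => dot x y *+ 2))
        \+ cst (dot y y) \+ (fun x => s x ^+ 2).
      by apply/funext => x; rewrite /F/= !(dotBl, dotBr) (dotC y x); ring.
    have dxxc : {within B `&` K, continuous (fun x => dot x x)}.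
      exact/continuous_subspaceT/dotxx_continuous.
    have dyc : {within B `&` K, continuous (fun x => dot x y)}.
      exact/continuous_subspaceT/dot_continuous.
    have sc : {within B `&` K, continuous s}.
      move=> x.
      apply: (@continuous_max R (subspace (B `&` K)) (cst 0)
        (fun z => T - f z) x).
        exact: cvg_cst.
      apply: cvgB; first exact: cvg_cst.
      exact: (continuous_subspaceW (@subIsetr _ B K) fc).
    move=> x; apply: cvgD; last by apply: cvgM; exact: sc.
    apply: cvgD; last exact: cvg_cst.
    apply: cvgB; first exact: dxxc.
    by apply: cvgD; exact: dyc.
  have [x0 /set_mem[_ Kx0] x0min] :=
    EVT_min_rV (ex_intro _ y KBy) compactKB Fc.
  exists x0 => // x Kx; have [Bx|nBx] := pselect (B x).
    by apply: x0min; rewrite inE.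
  apply: le_trans (x0min y (mem_set KBy)) _; rewrite Fy.
  rewrite leNgt; apply/negP => Fxe; apply: nBx => k /=; rewrite in_itv/=.
  rewrite -ler_distl -ler_sqr ?nnegrE ?(ltW e0)// real_normK ?num_real//.
  have := sqr_coord_le (x - y) k; rewrite !mxE => /le_trans; apply.
  by apply: ltW; apply: le_lt_trans Fxe; rewrite lerDl sqr_ge0.
have [v vE] : exists v, v = x0 - y by exists (x0 - y).
(* First-order optimality of [x0] in a direction [w] along which [f] grows at rate at least [c]. *)
have variation w c :
    (forall t, 0 < t <= 1 ->
      K (x0 + t *: w) /\ f x0 + t * c <= f (x0 + t *: w)) ->
    s x0 * c <= dot v w.
  move=> wc; rewrite leNgt; apply/negP => vw.
  pose A := s x0 * c - dot v w; pose B := dot w w + c ^+ 2.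
  have A0 : 0 < A by rewrite subr_gt0.
  have B0 : 0 <= B by rewrite addr_ge0 ?sqr_ge0 ?dotxx_ge0.
  (* Minimality requires [t * B >= 2 * A], but this choice gives [t * B = A - t * A < 2 * A]. *)
  pose t := A / (A + B).
  have t0 : 0 < t by rewrite divr_gt0// ltr_wpDr.
  have t1 : t <= 1 by rewrite ler_pdivrMr ?mul1r ?lerDl// ltr_wpDr.
  have tAB : t * (A + B) = A by rewrite divfK// gt_eqF// ltr_wpDr.
  have [|Kw fw] := wc t; first by rewrite t0.
  have sw : s (x0 + t *: w) ^+ 2 <= (s x0 - t * c) ^+ 2.
    rewrite [s (x0 + _)]/s; case: (leP 0 (T - _)) => h;
      last by rewrite expr0n sqr_ge0.
    by have := Ts x0 => Tsx0; rewrite ler_sqr ?nnegrE//; lra.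
  have := Fmin _ Kw; rewrite /F (addrAC x0) -vE !(dotDl, dotDr, dotZl, dotZr).
  rewrite (dotC w v) => Fw.
  have : 0 <= t * (t * B - 2 * A) by rewrite /A /B; lra.
  by rewrite pmulr_rge0//; nra.
have vlower x : K x -> s x0 * f x <= dot v x.
  move=> Kx; apply: variation => t /andP[/ltW t0 _].
  have Ktx := KZ _ _ Kx t0; split; first exact: KD.
  by rewrite -fZ//; exact: fD.
(* The direction is [- x0]: shrinking along the ray stays in the cone and changes [f] linearly. *)
have vx0 : dot v x0 <= s x0 * f x0.
  rewrite -lerN2 -mulrN -[- dot v x0]mulN1r -dotZr; apply: variation => t /andP[_ t1].
  have t10 : 0 <= 1 - t by rewrite subr_ge0.
  have -> : x0 + t *: (-1 *: x0) = (1 - t) *: x0.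
    by rewrite scalerA mulrN1 scalerBl scale1r scaleNr.
  by split; [exact: KZ|rewrite fZ// mulrBl mul1r mulrN].
have vyE : dot v y = dot v x0 - dot v v by rewrite -dotBr vE subKr.
(* If [s x0 = 0], then [dot v x0 <= 0 <= dot v y], so [dot v v <= 0] and [x0 = y]; but [s y = e]. *)
have sx0 : 0 < s x0.
  rewrite lt_def s0 andbT; apply/eqP => sx00.
  have : dot v v <= 0.
    by have := vlower y Ky; rewrite vyE; move: vx0; rewrite sx00 !mul0r; lra.
  rewrite le_eqVlt ltNge dotxx_ge0 orbF dotxx_eq0 vE subr_eq0 => /eqP x0y.
  move: sx00; rewrite x0y /s /T addrAC subrr add0r max_r ?ltW// => e00.
  by move: e0; rewrite e00 ltxx.
exists ((s x0)^-1 *: v) => [x Kx|].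
  by rewrite dotZl ler_pdivlMl// vlower.
rewrite dotZl ltr_pdivrMl//.
(* Hence [dot v y <= s x0 * f x0 = s x0 * (T - s x0) < s x0 * T]. *)
have sE : s x0 = T - f x0.
  by move: sx0; rewrite /s; case: (leP 0 (T - _)) => //; rewrite ltxx.
by have := dotxx_ge0 v; rewrite -/T vyE; nra.
Qed.

(** * Projection onto an admissible hyperplane *)

Definition normal_proj (R : realType) (d : nat) (a x : 'rV[R]_d) : 'rV[R]_d :=
  x - (dot a x / dot a a) *: a.

Section AdmissibleHyperplane.
Variables (R : realType) (d : nat) (V : set 'rV[R]_d) (a : 'rV[R]_d).
Hypotheses (admV : admissible V) (a0 : a != 0) (Va : V = [set x | dot a x = 0]).
Implicit Types x y z : 'rV[R]_d.

(** Subtracting [x 0 i - mu * x 0 j] from coordinate [i] moves [x] into [V], where [dot a] vanishes;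
    hence [al = a 0 i]. *)
Lemma normal_admissible : exists (i j : 'I_d) (mu al : R),
  [/\ i != j, 0 <= mu, al != 0 & forall x, dot a x = al * (x 0 i - mu * x 0 j)].
Proof.
have [i [j [mu [ij mu0 Vij]]]] := admV; exists i, j, mu, (a 0 i).
have aE x : dot a x = a 0 i * (x 0 i - mu * x 0 j).
  set r := _ - _; have : V (x - r *: delta_mx 0 i).
    rewrite Vij/= !mxE !eqxx (eq_sym j) (negPf ij)/= /r; ring.
  rewrite Va/= dotBr dotZr dot_delta => /eqP.
  by rewrite subr_eq0 mulrC => /eqP.
split=> //; apply: contraNneq a0 => ai0.
by rewrite -dotxx_eq0 aE ai0 mul0r.
Qed.

Lemma dot_normal_proj x : dot a (normal_proj a x) = 0.
Proof. by rewrite dotBr dotZr divfK ?subrr// dotxx_eq0. Qed.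

(** Two candidates for the projection differ by a vector that is both in [V] and orthogonal to [V],
    hence zero. *)
Lemma orthogonal_projE x : orthogonal_proj V x = normal_proj a x.
Proof.
have Vproj : V (normal_proj a x) by rewrite Va/= dot_normal_proj.
apply: xget_unique => [|p [Vp px]].
  split=> // v; rewrite Va/= => av.
  by rewrite /normal_proj subKr dotZl av mulr0.
have VB : V (p - normal_proj a x).
  by move: Vp Vproj; rewrite Va/= dotBr => -> ->; rewrite subrr.
apply/eqP; rewrite -subr_eq0 -dotxx_eq0.
have wE : p - normal_proj a x = (dot a x / dot a a) *: a - (x - p).
  by apply/rowP => k; rewrite !mxE; ring.
by rewrite {1}wE dotBl dotZl px//; move: VB; rewrite Va/= => ->; rewrite mulr0 subrr.
Qed.

Lemma dot_proj_decomp x y :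
  dot x y = dot (normal_proj a x) (normal_proj a y) + dot a x * dot a y / dot a a.
Proof.
have aa0 : dot a a != 0 by rewrite dotxx_eq0.
rewrite /normal_proj !(dotBl, dotBr, dotZl, dotZr) (dotC x a).
by field.
Qed.

Lemma dot_projl x z : V z -> dot x z = dot (normal_proj a x) z.
Proof. by rewrite Va/= => az; rewrite dotBl dotZl az mulr0 subr0. Qed.

(** Only coordinates [i] and [j] change; they become [mu * c] and [c] with
    [c = (mu * x 0 i + x 0 j) / (1 + mu ^+ 2)]. *)
Lemma orthant_proj x : orthant x -> orthant (normal_proj a x).
Proof.
have [i [j [mu [al [ij mu0 al0 aE]]]]] := normal_admissible.
move=> x0 k.
have aiE : a 0 i = al.
  by rewrite -dot_delta aE !mxE !eqxx (eq_sym j) (negPf ij)/=; ring.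
have ajE : a 0 j = - (al * mu).
  by rewrite -dot_delta aE !mxE !eqxx (negPf ij)/=; ring.
have den0 : 0 < 1 + mu ^+ 2 by rewrite ltr_wpDr ?sqr_ge0.
have rE : dot a x / dot a a = (x 0 i - mu * x 0 j) / (al * (1 + mu ^+ 2)).
  rewrite !aE aiE ajE; field.
  rewrite al0 gt_eqF// (_ : _ - _ = al * (1 + mu ^+ 2)); last by ring.
  by rewrite mulf_neq0// gt_eqF.
rewrite /normal_proj !mxE rE.
have [->|ki] := eqVneq k i.
  rewrite aiE (_ : _ - _ = mu * (mu * x 0 i + x 0 j) / (1 + mu ^+ 2)); last first.
    by field; rewrite al0 gt_eqF.
  by rewrite divr_ge0 ?(ltW den0)// mulr_ge0// addr_ge0// mulr_ge0.
have [->|kj] := eqVneq k j.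
  rewrite ajE (_ : _ - _ = (mu * x 0 i + x 0 j) / (1 + mu ^+ 2)); last first.
    by field; rewrite al0 gt_eqF.
  by rewrite divr_ge0 ?(ltW den0)// addr_ge0// mulr_ge0.
have -> : a 0 k = 0.
  rewrite -dot_delta aE !mxE (eq_sym i) (eq_sym j) (negPf ki) (negPf kj)/=; ring.
by rewrite mulr0 subr0.
Qed.

(** Testing [l] on [mu e_i + e_j], on the [e_k] with [k] different from [i] and [j], and on
    whichever of [e_i], [e_j] the sign of [al] allows leaves one coordinate, which [dot a l <= 0]
    controls. *)
Lemma orthant_of_nonneg_functional l :
    (forall x, orthant x -> 0 <= dot a x -> 0 <= dot l x) -> dot a l <= 0 ->
  orthant l.
Proof.
have [i [j [mu [al [ij mu0 al0 aE]]]]] := normal_admissible.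
move=> l0; rewrite aE => al_le0.
have delta0 (k : 'I_d) : orthant (delta_mx 0 k : 'rV[R]_d).
  by move=> m; rewrite mxE ler0n.
have l_mu : 0 <= mu * l 0 i + l 0 j.
  rewrite -!dot_delta -dotZr -dotDr; apply: l0.
    by apply: orthantD => //; exact: orthantZ.
  by rewrite aE !mxE !eqxx (negPf ij) (eq_sym j) (negPf ij)/=; lra.
have [al_gt0|al_le] := ltP 0 al.
  have li0 : 0 <= l 0 i.
    rewrite -dot_delta; apply: l0 => //.
    by rewrite aE !mxE !eqxx (eq_sym j) (negPf ij)/=; lra.
  move: al_le0; rewrite pmulr_rle0// => lij.
  (* A negative [l 0 j] would force [l 0 i = 0] through [lij], contradicting [l_mu]. *)
  have lj0 : 0 <= l 0 j by nra.
  move=> k; have [->//|ki] := eqVneq k i; have [->//|kj] := eqVneq k j.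
  rewrite -dot_delta; apply: l0 => //.
  rewrite aE !mxE (eq_sym i) (eq_sym j) (negPf ki) (negPf kj)/=; lra.
have al_lt0 : al < 0 by rewrite lt_neqAle al0.
have lj0 : 0 <= l 0 j.
  rewrite -dot_delta; apply: l0 => //.
  rewrite aE !mxE !eqxx (negPf ij)/=; nra.
have li0 : 0 <= l 0 i.
  by move: al_le0; rewrite nmulr_rle0//; nra.
move=> k; have [->//|ki] := eqVneq k i; have [->//|kj] := eqVneq k j.
rewrite -dot_delta; apply: l0 => //.
rewrite aE !mxE (eq_sym i) (eq_sym j) (negPf ki) (negPf kj)/=; lra.
Qed.

End AdmissibleHyperplane.

(** * Self-duality of the extension *)

Theorem theorem1 (R : realType) (d : nat) (hd : (2 <= d)%N)
    (V K1 K2 : set 'rV[R]_d)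
    (hV : admissible V) (hK : closed_parts V K1 K2)
    (phi : 'rV[R]_d -> R)
    (hphi : antinorm (@orthant R d `&` V) phi)
    (hphi_sd : self_dual (@orthant R d `&` V) phi)
    (f1 : 'rV[R]_d -> R) (hf1 : antinorm K1 f1)
    (hf1_phi : forall x, (@orthant R d `&` V) x -> f1 x = phi x)
    (hf1_le : forall x, K1 x -> f1 x <= orthogonal_extension V phi x) :
  antinorm (@orthant R d) (dual_extension K1 f1) /\
  self_dual (@orthant R d) (dual_extension K1 f1).
Proof.
have [a [a0 Va K1E _]] := hK.
have [_ phi_ge0 phi_gt0 phiZ _] := hphi.
have [_ f1_ge0 f1_gt0 f1Z _] := hf1.
have aa_gt0 := dotxx_gt0 a0.
set K' := @orthant R d `&` V.
set f := dual_extension K1 f1.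
have K1_orthant : K1 `<=` @orthant R d by rewrite K1E => x [].
have K'_orthant : K' `<=` @orthant R d by move=> x [].
have K'_K1 : K' `<=` K1 by rewrite K1E /K' Va => x [x0 /= ax]; rewrite /= ax.
have K'_proj x : orthant x -> K' (normal_proj a x).
  move=> x0; split; first exact: orthant_proj hV a0 Va _ x0.
  by rewrite Va; exact: dot_normal_proj.
have fK1 x : K1 x -> f x = f1 x by move=> /mem_set K1x; rewrite /f /dual_extension K1x.
have fNK1 x : ~ K1 x -> f x = antinorm_dual K1 f1 x.
  by move=> nK1x; rewrite /f /dual_extension memNset.
have f_ge0 x : orthant x -> 0 <= f x.
  move=> x0; have [/[dup] K1x /fK1->|/fNK1->] := pselect (K1 x); first exact: f1_ge0.
  apply: le_antinorm_dual => // z K1z; rewrite mul0r dot_ge0//; exact: K1_orthant.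
(* The bound by the orthogonal extension spreads to the whole orthant: off [K1], restricting the
   infimum to [K'] gives the dual of [phi] at the projection of [x]. *)
have f_le x : orthant x -> f x <= phi (normal_proj a x).
  move=> x0; have [/[dup] K1x /fK1->|/fNK1->] := pselect (K1 x).
    by rewrite -(orthogonal_projE a0 Va); exact: hf1_le.
  rewrite -hphi_sd; last exact: K'_proj.
  apply: le_antinorm_dual => // z K'z; rewrite -(dot_projl Va); last by case: K'z.
  by rewrite -hf1_phi//; apply: antinorm_dual_mul_le => //; exact: K'_K1.
have phi_mul x y : K' x -> K' y -> phi x * phi y <= dot x y.
  move=> K'x K'y; rewrite -(hphi_sd x K'x).
  by apply: antinorm_dual_mul_le => //; exact: K'_orthant.
(* On the same side of V the normal components have equal signs, so
   (x, y) >= (x', y') >= phi x' * phi y'. *)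
have f_mul_same x y : orthant x -> orthant y -> 0 <= dot a x * dot a y ->
    f x * f y <= dot x y.
  move=> x0 y0 axy; rewrite (dot_proj_decomp a0).
  apply: (@le_trans _ _ (phi (normal_proj a x) * phi (normal_proj a y))).
    by apply: ler_pM; rewrite ?f_ge0 ?f_le.
  apply: (@le_trans _ _ (dot (normal_proj a x) (normal_proj a y))).
    by apply: phi_mul; exact: K'_proj.
  by rewrite lerDl divr_ge0// ltW.
have nK1 x : orthant x -> ~ K1 x -> dot a x < 0.
  by move=> x0 nK1x; rewrite ltNge; apply/negP => ax; apply: nK1x; rewrite K1E.
have f_mul x y : orthant x -> orthant y -> f x * f y <= dot x y.
  move=> x0 y0.
  have [K1x|nK1x] := pselect (K1 x); have [K1y|nK1y] := pselect (K1 y).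
  - apply: f_mul_same => //; move: K1x K1y; rewrite K1E => -[_ ax] [_ ay].
    exact: mulr_ge0.
  - by rewrite mulrC dotC fNK1// fK1//; exact: antinorm_dual_mul_le.
  - by rewrite fNK1// fK1//; exact: antinorm_dual_mul_le.
  - by apply: f_mul_same => //; rewrite mulr_le0// ltW// nK1.
have f_gt0 : exists2 x, orthant x & 0 < f x.
  have [x K1x fx0] := f1_gt0; exists x; first exact: K1_orthant.
  by rewrite fK1.
have closedK1 : closed K1.
  rewrite K1E; apply: closedI; first exact: closed_orthant.
  exact: closed_dot_ge0.
have K1D x z : K1 x -> K1 z -> K1 (x + z).
  rewrite K1E => -[x0 /= ax] [z0 /= az]; split; first exact: orthantD.
  by rewrite /= dotDr addr_ge0.
have K1Z t z : K1 z -> 0 <= t -> K1 (t *: z).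
  rewrite K1E => -[z0 /= az] t0; split; first exact: orthantZ.
  by rewrite /= dotZr mulr_ge0.
have sd : self_dual (@orthant R d) f.
  move=> y y0; apply/eqP; rewrite eq_le; apply/andP; split; last first.
    by apply: le_antinorm_dual => // x x0; exact: f_mul.
  (* Bounding the dual at [y] thus amounts to finding a point [x] with [f x >= 1] and small
     [dot y x]. *)
  have dual_le x : orthant x -> 1 <= f x -> antinorm_dual (@orthant R d) f y <= dot y x.
    move=> x0 fx1.
    apply: le_trans (antinorm_dual_mul_le (@subset_refl _ _) f_ge0 y0 x0).
    rewrite ler_peMr// le_antinorm_dual// => z z0.
    by rewrite mul0r dot_ge0.
  have [K1y|nK1y] := pselect (K1 y); last first.
    rewrite [leRHS]fNK1//; apply: le_antinorm_dual => // x K1x.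
    rewrite -(fK1 x K1x); apply: antinorm_dual_mul_le => //; exact: K1_orthant.
  rewrite [leRHS]fK1//; apply/ler_addgt0Pr => e e0.
  have [l lf1 ly] := antinorm_supporting closedK1 K1D K1Z hf1 K1y e0.
  have l_ge0 x : K1 x -> 0 <= dot l x.
    by move=> K1x; rewrite (le_trans (f1_ge0 _ K1x))// lf1.
  have ay : 0 <= dot a y by move: K1y; rewrite K1E => -[].
  have [al|al] := leP 0 (dot a l).
  (* Projection is self-adjoint, so the projected functional at [x] equals [l] at the projection of
     [x], a point of [K1]. *)
  - have l'_ge0 x : orthant x -> 0 <= dot a x -> 0 <= dot (normal_proj a l) x.
      move=> x0 _; have K'x := K'_proj x x0.
      rewrite dotC (dot_projl Va); last by rewrite Va; exact: dot_normal_proj.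
      rewrite dotC -(dot_projl Va); last by case: K'x.
      by apply: l_ge0; exact: K'_K1.
    have K'l : K' (normal_proj a l).
      split; last by rewrite Va; exact: dot_normal_proj.
      apply: (orthant_of_nonneg_functional hV a0 Va) => //.
      by rewrite dot_normal_proj.
    (* Projecting [l] removes the term [dot a l * dot a y / dot a a], which is nonnegative here. *)
    apply: (@le_trans _ _ (dot y (normal_proj a l))); last first.
      apply: le_trans (ltW ly); rewrite dotC /normal_proj dotBl dotZl gerBl.
      by rewrite mulr_ge0// divr_ge0// ltW.
    apply: dual_le; first by case: K'l.
    (* On [K'] the projected functional agrees with [l], which dominates [f1 = phi]; self-duality of
       [phi] gives the value at least 1. *)
    rewrite fK1; last exact: K'_K1.
    rewrite hf1_phi// -hphi_sd//; apply: le_antinorm_dual => // x K'x.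
    rewrite mul1r -(dot_projl Va); last by case: K'x.
    by rewrite -hf1_phi// lf1//; exact: K'_K1.
  - have l0 : orthant l.
      apply: (orthant_of_nonneg_functional hV a0 Va); last exact: ltW.
      by move=> x x0 ax; apply: l_ge0; rewrite K1E.
    apply: le_trans (ltW ly); rewrite dotC; apply: dual_le => //.
    rewrite fNK1; last by rewrite K1E => -[_ /=]; rewrite leNgt al.
    by apply: le_antinorm_dual => // x K1x; rewrite mul1r lf1.
by split=> //; exact: self_dual_antinorm.
Qed.
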